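(* Let $\nu\in(0,1)$ and $M_0\ge1$. There exists a constant $N=N(n,\nu,M_0)>0$ such that the following holds. Suppose that $\beta:\mathbb{R}^n\to[0,\infty)$ is a weight with $\beta^{-1}\in A_{1+\frac2{n_0}}$, $[\beta^{-1}]_{A_{1+\frac2{n_0}}}\le M_0$, $n_0=\max\{n,2\}$, and that for some $r>0$, $\mathbf{A}$ is a measurable matrix-valued function with $\nu|\xi|^2\le\langle\mathbf{A}(x,t)\xi,\xi\rangle$, $|\mathbf{A}(x,t)|\le\nu^{-1}$ for all $(x,t)\in Q^+_{r,\beta}$, $\xi\in\mathbb{R}^n$. Suppose also that $u\in\hat{\mathcal{W}}^{1,2}(Q^+_{r,\beta},\beta)$ is a weak solution of $$\beta(x)u_t-\operatorname{div}(\mathbf{A}(x,t)\nabla u)=\operatorname{div}(F(x,t))\ \text{ in }Q^+_{r,\beta},\qquad u=0\ \text{ on }T_r\times\Gamma_\beta(r),$$ with $F\in L^2(Q^+_{r,\beta})^n$. Then $$\int_{Q^+_{r,\beta}}|u|^2dxdt\le N\Big[r^2\int_{Q^+_{r,\beta}}\big(|\nabla u|^2+|F|^2\big)dxdt+\Big(\frac1{\beta(B_r)}\int_{B_r}\Theta_{\beta,r}(x)^2dx\Big)\Big(\int_{Q^+_{r,\beta}}|u|^2dxdt\Big)\Big].$$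
   Context: For $q\in(1,\infty)$ and locally integrable $\mu\ge0$ on $\mathbb{R}^n$, $[\mu]_{A_q}=\sup_{B}\big(\fint_B\mu\big)\big(\fint_B\mu^{-\frac1{q-1}}\big)^{q-1}$ over all balls $B$, and $\mu\in A_q$ means $[\mu]_{A_q}<\infty$. $B_r$ is the ball of radius $r$ centered at $0$; $B_r^+=B_r\cap\{x_n>0\}$; $T_r=B_r\cap\{x_n=0\}$; $(f)_E$ is the average of $f$ over $E$; $\beta(E)=\int_E\beta\,dx$; $\Gamma_\beta(r)=(-r^2\Psi_\beta(r),0]$ with $\Psi_\beta(r)=\big(\fint_{B_r}\beta^{n_0/2}dx\big)^{2/n_0}$; $Q^+_{r,\beta}=B_r^+\times\Gamma_\beta(r)$; $\Theta_{\beta,r}(x)=|\beta(x)-(\beta)_{B_r}|\beta(x)^{-1/2}$. $\hat{\mathcal{W}}^{1,2}(B_r^+\times I,\beta)$ is the set of $u\in L^2(I,W^{1,2}(B_r^+))$ with zero trace on $T_r\times I$ and $\beta u_t\in L^2(I,W^{-1,2}(B_r^+))$ ($W^{-1,2}$ the dual of $W^{1,2}_0$). Weak solution means $-\int_{Q^+}\beta u\,\partial_t\varphi+\int_{Q^+}\langle\mathbf{A}\nabla u,\nabla\varphi\rangle=-\int_{Q^+}\langle F,\nabla\varphi\rangle$ for every smooth $\varphi$ with compact support in the interior of $Q^+=Q^+_{r,\beta}$. *)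

(* Defs.v *)
From HB Require Import structures.
From mathcomp Require Import all_boot all_order all_algebra.
From mathcomp Require Import all_classical all_reals all_analysis.

Set Implicit Arguments.
Unset Strict Implicit.
Unset Printing Implicit Defensive.
Import Order.TTheory GRing.Theory Num.Theory.
Import numFieldNormedType.Exports.

Local Open Scope classical_set_scope.
Local Open Scope ring_scope.

Section measurable_rV.
Context {R : realType} {n : nat}.

Let coord : 'I_n -> 'rV[R]_n -> R := fun i x => x ord0 i.

Let rV_set0 : g_sigma_preimage coord set0.
Proof. exact: sigma_algebra0. Qed.

Let rV_setC A : g_sigma_preimage coord A -> g_sigma_preimage coord (~` A).
Proof. exact: sigma_algebraC. Qed.

Let rV_bigcup (F : _^nat) : (forall i, g_sigma_preimage coord (F i)) ->
  g_sigma_preimage coord (\bigcup_i (F i)).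
Proof. exact: sigma_algebra_bigcup. Qed.

(* the sigma-algebra generated by the coordinates, i.e. the Borel one *)
HB.instance Definition _ := @isMeasurable.Build default_measure_display
  'rV[R]_n (g_sigma_preimage coord) rV_set0 rV_setC rV_bigcup.

Lemma measurable_coord (i : 'I_n) :
  measurable_fun [set: 'rV[R]_n] (fun x : 'rV[R]_n => x ord0 i).
Proof.
move=> _ Y mY; rewrite setTI; apply: sub_sigma_algebra => /=.
rewrite -bigcup_seq/=; exists i => /=; first by rewrite mem_index_enum.
by exists Y => //; rewrite setTI.
Qed.

Lemma measurable_fun_rV d (T : measurableType d) (f : T -> 'rV[R]_n) :
  (forall i, measurable_fun [set: T] (fun x => f x ord0 i)) ->
  measurable_fun [set: T] f.
Proof.
move=> mf; apply: (@measurability _ _ _ _ setT f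
  (\big[setU/set0]_(i < n) preimage_set_system setT (coord i) measurable)) => //.
move=> _ [B + <-]; rewrite -bigcup_seq/= => -[i _ [Y mY <-]].
by rewrite setTI; apply: mf.
Qed.

End measurable_rV.

(* x = (x', x_n), the last coordinate being singled out *)
Definition rcons_rV {R : realType} {n : nat} (p : 'rV[R]_n * R) : 'rV[R]_n.+1 :=
  \row_i (if unlift ord_max i is Some j then p.1 ord0 j else p.2).

Lemma measurable_rcons_rV {R : realType} {n : nat} :
  measurable_fun setT (@rcons_rV R n).
Proof.
apply: measurable_fun_rV => i; rewrite /rcons_rV.
under eq_fun do rewrite mxE.
case: (unlift ord_max i) => [j|]; last exact: measurable_snd.
exact: (measurableT_comp (measurable_coord j) measurable_fst).
Qed.

Section lebn_succ.
Context {R : realType} {n : nat} (m : {measure set 'rV[R]_n -> \bar R}).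

Definition lebn_succ : set 'rV[R]_n.+1 -> \bar R :=
  pushforward (m \x (@lebesgue_measure R))%E rcons_rV.

Let lebn_succ0 : lebn_succ set0 = 0%E.
Proof. by rewrite /lebn_succ /pushforward preimage_set0 measure0. Qed.

Let lebn_succ_ge0 A : (0 <= lebn_succ A)%E.
Proof. by rewrite /lebn_succ /pushforward; apply: measure_ge0. Qed.

Let lebn_succ_sigma_additive : semi_sigma_additive lebn_succ.
Proof.
move=> F mF tF mUF; rewrite /lebn_succ /pushforward preimage_bigcup.
apply: measure_semi_sigma_additive.
- by move=> k; rewrite -[X in measurable X]setTI; exact: measurable_rcons_rV.
- apply/trivIsetP => /= i j _ _ ij; rewrite -preimage_setI.
  by move/trivIsetP : tF => /(_ _ _ _ _ ij) ->//; rewrite preimage_set0.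
- by rewrite -preimage_bigcup -[X in measurable X]setTI; exact: measurable_rcons_rV.
Qed.

HB.instance Definition _ := isMeasure.Build _ _ _ lebn_succ
  lebn_succ0 lebn_succ_ge0 lebn_succ_sigma_additive.

End lebn_succ.

Fixpoint lebn {R : realType} (n : nat) : {measure set 'rV[R]_n -> \bar R} :=
  match n with
  | 0 => dirac (0 : 'rV[R]_0)
  | n'.+1 => lebn_succ (lebn n')
  end.

Definition lebn_xt {R : realType} (n : nat) :
  {measure set ('rV[R]_n * measurableTypeR R)%type -> \bar R} :=
  (lebn n \x lebesgue_measure)%E.

(* Measurability for the completion of mu: for Lebesgue measure this is Lebesgue
   measurability, whereas measurable_fun is Borel measurability. Such an f agrees
   off a null set with a Borel function, so that \int[mu] has its usual value. *)
Definition aemeasurable d (T : measurableType d) (R : realType)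
    (mu : {measure set T -> \bar R}) (D : set T) (f : T -> R) :=
  exists2 g : T -> R, measurable_fun D g & f = g %[ae mu in D].

Definition L2 d (T : measurableType d) (R : realType)
    (mu : {measure set T -> \bar R}) (D : set T) (f : T -> R) :=
  aemeasurable mu D f /\ (\int[mu]_(x in D) (f x ^+ 2)%:E < +oo)%E.

Definition n0 (dim : nat) : nat := maxn dim 2.

Section euclidean.
Context {R : realType} {n : nat}.
Implicit Types (x y : 'rV[R]_n) (f : 'rV[R]_n -> R) (E : set 'rV[R]_n).

Definition dotv x y : R := \sum_(i < n) x ord0 i * y ord0 i.

(* the norm `|x| of 'rV[R]_n is the sup norm *)
Definition enorm x : R := Num.sqrt (dotv x x).

Definition eball x (r : R) : set 'rV[R]_n := [set y | enorm (y - x) < r].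

Definition emean f E : \bar R :=
  ((lebn n E)^-1 * \int[lebn n]_(x in E) (f x)%:E)%E.

Definition mean f E : R := fine (emean f E).

(* Locally integrable and positive a.e.: a weight is finite a.e. together with its
   inverse. For the inverse of beta : R^n -> [0, oo) this is implied by the local
   integrability of 1/beta with 1/0 = oo, but has to be stated since 0^-1 = 0. *)
Definition weight f :=
  [/\ aemeasurable (lebn n) setT f, forall x, 0 <= f x,
      {ae lebn n, forall x, 0 < f x} &
      forall r, (\int[lebn n]_(x in eball 0 r) (f x)%:E < +oo)%E].

Definition Aq_char (q : R) f : \bar R :=
  ereal_sup [set s | exists (c : 'rV[R]_n) (rho : R), 0 < rho /\
    s = (emean f (eball c rho) *
         emean (fun x => f x `^ (- (q - 1)^-1))%R (eball c rho) `^ (q - 1))%E].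

Definition Aq (q : R) f := weight f /\ (Aq_char q f < +oo)%E.

End euclidean.

Section smooth.
Context {R : realType} {V : normedModType R}.

Fixpoint Ck (k : nat) (f : V -> R) : Prop :=
  match k with
  | 0 => continuous f
  | k'.+1 => continuous f /\
      forall v, (forall x, derivable f x v) /\ Ck k' ('D_v f)
  end.

Definition smooth (f : V -> R) := forall k, Ck k f.

Definition tsupport (f : V -> R) : set V := closure [set x | f x != 0].

Definition test_fun (U : set V) (f : V -> R) :=
  [/\ smooth f, compact (tsupport f) & tsupport f `<=` U].

End smooth.

Section sobolev.
Context {R : realType} {n : nat}.
Local Notation V := 'rV[R]_n.+1.
Implicit Types (Om : set V) (v : V -> R) (g : V -> V).

Definition grad v : V -> V := fun x => \row_i 'D_(delta_mx ord0 i) v x.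

Definition weak_grad Om v g := forall phi, test_fun Om phi -> forall i,
  (\int[lebn n.+1]_(x in Om) (v x * grad phi x ord0 i)) =
  - (\int[lebn n.+1]_(x in Om) (g x ord0 i * phi x)).

(* v is in W^{1,2}(Om) and g is its gradient; Om is meant to be open *)
Definition W12 Om v g :=
  [/\ L2 (lebn n.+1) Om v, forall i, L2 (lebn n.+1) Om (fun x => g x ord0 i) &
      weak_grad Om v g].

(* the square of the W^{1,2} norm *)
Definition W12_sqnorm Om v g : \bar R :=
  ((\int[lebn n.+1]_(x in Om) (v x ^+ 2)%:E) +
   (\int[lebn n.+1]_(x in Om) (dotv (g x) (g x))%:E))%E.

Definition W12_cvg Om (phi : (V -> R)^nat) v g :=
  (fun k => W12_sqnorm Om (phi k \- v) (fun x => grad (phi k) x - g x)) @ \oo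
    --> 0%E.

Definition W12_0 Om v g :=
  W12 Om v g /\ exists2 phi : (V -> R)^nat,
    forall k, test_fun Om (phi k) & W12_cvg Om phi v g.

Definition dual_norm Om (l : (V -> R) -> R) : \bar R :=
  ereal_sup [set s | exists v g,
    [/\ W12_0 Om v g, (W12_sqnorm Om v g <= 1)%E & s = `|l v|%:E]].

(* l is in W^{-1,2}(Om), the dual of W^{1,2}_0(Om) *)
Definition W12_dual Om (l : (V -> R) -> R) :=
  (forall (a : R) v g w h, W12_0 Om v g -> W12_0 Om w h ->
     l (fun x => a * v x + w x) = a * l v + l w) /\
  (dual_norm Om l < +oo)%E.

Definition halfball (r : R) : set V :=
  [set x | eball 0 r x /\ 0 < x ord0 ord_max].

Definition flat (r : R) : set 'rV[R]_n := [set x' | eball 0 r (rcons_rV (x', 0))].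

(* The trace is the continuous extension to W^{1,2} of the restriction to T_r of
   functions smooth up to the boundary; flat r is T_r as a subset of R^{n-1}. *)
Definition zero_trace (r : R) v g := exists2 phi : (V -> R)^nat,
  (forall k, smooth (phi k)) /\ W12_cvg (halfball r) phi v g &
  (fun k => \int[lebn n]_(x' in flat r) (phi k (rcons_rV (x', 0)) ^+ 2)%:E)%E @ \oo
    --> 0%E.

End sobolev.

Section parabolic.
Context {R : realType} {n : nat}.
Local Notation V := 'rV[R]_n.+1.
Implicit Types (Om : set V) (I : set R) (r : R) (beta : V -> R).
Implicit Types (u : V * R -> R) (Du F : V * R -> V).

Definition slice (X : Type) (u : V * R -> X) (t : R) : V -> X :=
  fun x => u (x, t).

Definition dt u : V * R -> R := fun z => 'D_((0 : V), (1 : R)) u z.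

Definition gradx u : V * R -> V := fun z => grad (slice u z.2) z.1.

Definition L2xt (Q : set (V * R)) Du :=
  forall i, L2 (lebn_xt n.+1) Q (fun z => Du z ord0 i).

(* u is in L^2(I, W^{1,2}(Om)) and Du is its spatial gradient *)
Definition L2W12 Om I u Du :=
  [/\ L2 (lebn_xt n.+1) (Om `*` I) u, L2xt (Om `*` I) Du &
      {ae lebesgue_measure, forall t, I t -> W12 Om (slice u t) (slice Du t)}].

(* l is in L^2(I, W^{-1,2}(Om)) *)
Definition L2W12_dual Om I (l : R -> (V -> R) -> R) :=
  [/\ {ae lebesgue_measure, forall t, I t -> W12_dual Om (l t)},
      forall v g, W12_0 Om v g ->
        aemeasurable lebesgue_measure I (fun t => l t v) &
      (\int[lebesgue_measure]_(t in I) (dual_norm Om (l t) ^+ 2) < +oo)%E].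

Definition beta_dt_in_dual Om I beta u := exists2 l, L2W12_dual Om I l &
  forall phi, test_fun (Om `*` I)° phi ->
    - (\int[lebn_xt n.+1]_(z in Om `*` I) (beta z.1 * u z * dt phi z)) =
    \int[lebesgue_measure]_(t in I) l t (slice phi t).

(* u is in \hat W^{1,2}(B_r^+ x I, beta) and Du is its spatial gradient *)
Definition What r I beta u Du :=
  [/\ L2W12 (halfball r) I u Du,
      {ae lebesgue_measure,
        forall t, I t -> zero_trace r (slice u t) (slice Du t)} &
      beta_dt_in_dual (halfball r) I beta u].

Definition Psi beta r : R :=
  mean (fun x => beta x `^ ((n0 n.+1)%:R / 2)) (eball 0 r) `^ (2 / (n0 n.+1)%:R).

Definition Gam beta r : set R := `]- (r ^+ 2 * Psi beta r), 0].

Definition Qplus beta r : set (V * R) := halfball r `*` Gam beta r.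

Definition Theta beta r (x : V) : R :=
  `|beta x - mean beta (eball 0 r)| * beta x `^ (- 2^-1).

(* matrices act on column vectors; |A| is the operator norm *)
Definition elliptic (nu : R) (Q : set (V * R)) (A : V * R -> 'M[R]_n.+1) :=
  forall z, Q z -> forall xi : V,
    nu * enorm xi ^+ 2 <= dotv (xi *m (A z)^T) xi /\
    enorm (xi *m (A z)^T) <= nu^-1 * enorm xi.

Definition weak_solution (Q : set (V * R)) beta (A : V * R -> 'M[R]_n.+1) F u Du :=
  forall phi, test_fun Q° phi ->
    - (\int[lebn_xt n.+1]_(z in Q) (beta z.1 * u z * dt phi z)) +
      (\int[lebn_xt n.+1]_(z in Q) dotv (Du z *m (A z)^T) (gradx phi z)) =
    - (\int[lebn_xt n.+1]_(z in Q) dotv (F z) (gradx phi z)).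

End parabolic.

(* Main.v *)
From HB Require Import structures.
Require Import Defs.
From mathcomp Require Import all_boot all_order all_algebra.
From mathcomp Require Import all_classical all_reals all_analysis.
From mathcomp Require Import measurable_realfun ring lra.
Import Order.TTheory GRing.Theory Num.Theory.
Import numFieldNormedType.Exports.
Local Open Scope classical_set_scope.
Local Open Scope ring_scope.

(** The estimate is a Poincare inequality in the variable x_n. Since u vanishes on
    the flat part T_r of the boundary, and since the segment that joins a point x of
    B_r^+ to its projection on T_r stays in B_r^+ and is shorter than r, the value
    u(x, t) is the integral of the derivative D_n u along this segment; by the
    Cauchy-Schwarz inequality and integration over B_r^+,

      int u^2 dx <= C r^2 int |D_n u|^2 dx  for almost every t,

    and integration in t gives the first term of the right-hand side. The other
    terms are nonnegative, and N = 8.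

    For a smooth function with nonzero values on T_r the same computation gives a
    boundary term (poincare_smooth). The zero trace of u(., t) means that u(., t) is
    a W^{1,2}-limit of smooth functions whose values on T_r tend to 0 in L^2, which
    allows this term to be removed in the limit (poincare_zero_trace). The
    integration in t is poincare_slices. The Fubini-Tonelli theorem is used both to
    decompose the half-ball into vertical fibers and to decompose the cylinder into
    time slices. *)

(** * Comparison of integrals without measurability *)

(** The integral of a nonnegative function is the supremum of the integrals of
    the simple functions below it, so it is monotone for arbitrary functions.
    This is what allows integrands that are only measurable for the completed
    measure to be exchanged with Borel ones. *)
Section nonneg.
Local Open Scope ereal_scope.
Context d (T : measurableType d) (R : realType) (mu : {measure set T -> \bar R}).
Import HBNNSimple.

(** A simple function below f on D becomes a simple function below g, with the
    same integral, once it is set to zero on the exceptional null set. *)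
Lemma ae_le_integral_ge0 (D : set T) (f g : T -> \bar R) :
  (forall x, D x -> 0 <= f x) -> (forall x, D x -> 0 <= g x) ->
  {ae mu, forall x, D x -> f x <= g x} ->
  \int[mu]_(x in D) f x <= \int[mu]_(x in D) g x.
Proof.
move=> f0 g0 [N [mN N0 fgN]]; rewrite [leLHS]ge0_integralE// [leRHS]ge0_integralE//.
apply: ge_ereal_sup => _ [h hf <-].
pose h' := proj_nnsfun h (measurableC mN).
have h'E : h' = h \_ (~` N) :> (T -> R) by rewrite (mrestrict h (measurableC mN)).
apply: (@le_trans _ _ (sintegral mu h')); last first.
  apply: ereal_sup_ubound; exists h' => // x.
  have g0x : 0 <= (g \_ D) x.
    by rewrite /patch; case: ifPn => // /set_mem /g0.
  rewrite h'E [(h \_ _) x]/patch; case: ifPn => // /set_mem NNx.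
  apply: (le_trans (hf x)).
  rewrite /patch; case: ifPn => // /set_mem Dx.
  by apply: contrapT => fgx; apply/NNx/fgN => /(_ Dx).
have sE (k : {nnsfun T >-> R}) : sintegral mu k = \int[mu]_x (k x)%:E.
  by rewrite integral_nnsfun// patch_setT.
rewrite !sE; apply: ae_ge0_le_integral => //.
- by move=> x _; rewrite lee_fin.
- by apply/measurable_EFinP.
- by move=> x _; rewrite lee_fin.
- by apply/measurable_EFinP.
exists N; split => // x /=; apply: contra_notP => NNx _.
change ((h x)%:E <= (h' x)%:E); by rewrite h'E /patch mem_set.
Qed.

Lemma le_integral_ge0 (D : set T) (f g : T -> \bar R) :
  (forall x, D x -> 0 <= f x) -> (forall x, D x -> f x <= g x) ->
  \int[mu]_(x in D) f x <= \int[mu]_(x in D) g x.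
Proof.
move=> f0 fg; apply: ae_le_integral_ge0 => //; last exact: aeW.
by move=> x Dx; exact: le_trans (f0 _ Dx) (fg _ Dx).
Qed.

Lemma ae_eq_integral_ge0 (D : set T) (f g : T -> \bar R) :
  (forall x, D x -> 0 <= f x) -> (forall x, D x -> 0 <= g x) ->
  {ae mu, forall x, D x -> f x = g x} ->
  \int[mu]_(x in D) f x = \int[mu]_(x in D) g x.
Proof.
move=> f0 g0 fg; apply/eqP; rewrite eq_le; apply/andP.
by split; apply: ae_le_integral_ge0 => //; apply: filterS fg => x fgx /fgx ->.
Qed.

End nonneg.

(** * Borel measurability of continuous functions *)
Section borel.
Context {R : realType}.

(* the point of the grid k^-1 Z^n just below x *)
Let grid {n} (k : nat) (x : 'rV[R]_n) : 'rV[R]_n :=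
  \row_i ((Num.floor (k.+1%:R * x ord0 i))%:~R / k.+1%:R).

Let grid_cvg {n} (x : 'rV[R]_n) : grid ^~ x @ \oo --> x.
Proof.
move=> A [P Px PA]; rewrite /nbhs/=.
have : \forall k \near \oo, forall i : 'I_n, P ord0 i (grid k x ord0 i).
  apply: filter_forall => i; have := Px ord0 i.
  move=> /(@nbhs_ballP R)[e /= e0 eP].
  near=> k; apply: eP; rewrite /ball/= mxE.
  have k0 : 0 < k.+1%:R :> R by rewrite ltr0n.
  have /andP[fl1 fl2] := floor_itv (k.+1%:R * x ord0 i).
  rewrite ger0_norm; last by rewrite subr_ge0 ler_pdivrMr// [leRHS]mulrC.
  rewrite ltrBlDl -ltrBlDr ltr_pdivlMr//.
  apply: (@le_lt_trans _ _ (k.+1%:R * x ord0 i - 1)); last first.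
    by rewrite ltrBlDr -[1]/(1%:~R) -intrD.
  rewrite mulrBl [x _ _ * _]mulrC lerD2l lerN2 -ler_pdivrMr// div1r.
  by apply: ltW; near: k; exact: (near_infty_natSinv_lt (PosNum e0)).
by apply: filterS => k Pk; apply: PA => i j; rewrite ord1.
Unshelve. all: by end_near. Qed.

(** The sigma-algebra of R^n is generated by the coordinates, not by the open
    sets. A continuous f is the pointwise limit of the functions f o grid k,
    which are constant on each of countably many half-open cubes. *)
Lemma continuous_measurable_rV {n} (f : 'rV[R]_n -> R) :
  continuous f -> measurable_fun setT f.
Proof.
move=> cf; apply: (@measurable_fun_cvg _ _ _ _ (fun k => f \o grid k)); last first.
  by move=> x _; apply: continuous_cvg; [exact: cf|exact: grid_cvg].
move=> k _ Y mY; rewrite setTI.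
pose pt (z : 'rV[int]_n) : 'rV[R]_n := \row_i ((z ord0 i)%:~R / k.+1%:R).
pose cell (z : 'rV[int]_n) : set 'rV[R]_n :=
  if f (pt z) \in Y then
    \bigcap_i [set x | Num.floor (k.+1%:R * x ord0 i) = z ord0 i] else set0.
rewrite [X in measurable X](_ : _ = \bigcup_z cell z); last first.
  apply/seteqP; split=> [x Yx|x [z _]].
    exists (\row_i Num.floor (k.+1%:R * x ord0 i)) => //.
    rewrite /cell mem_set; first by move=> i _ /=; rewrite mxE.
    rewrite (_ : pt _ = grid k x)//.
    by apply/rowP => i; rewrite !mxE.
  rewrite /cell; case: ifPn => // /set_mem Yz xz.
  rewrite /= (_ : grid k x = pt z)//.
  by apply/rowP => i; rewrite !mxE (xz i).
apply: countable_bigcupT_measurable; first exact: countableP.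
move=> z; rewrite /cell; case: ifPn => [_|_]; last exact: measurable0.
rewrite -[X in measurable X]setCK setC_bigcap; apply: measurableC.
apply: countable_bigcupT_measurable; first exact: countableP.
move=> i; apply: measurableC.
have k0 : 0 < k.+1%:R :> R by rewrite ltr0n.
rewrite [X in measurable X](_ : _ = [set x : 'rV[R]_n | x ord0 i \in
  `[(z ord0 i)%:~R / k.+1%:R, (z ord0 i + 1)%:~R / k.+1%:R[ ]).
  rewrite -[X in measurable X]setTI.
  exact: (measurable_coord i measurableT (measurable_itv `[_, _[)).
apply/seteqP; split=> x /=; rewrite in_itv/=.
  move=> <-; rewrite ler_pdivrMr// ltr_pdivlMr// [x _ _ * _]mulrC.
  exact: floor_itv.
rewrite ler_pdivrMr// ltr_pdivlMr// [_ * k.+1%:R]mulrC => /andP[h1 h2].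
by apply: floor_def; rewrite h1. Show.
Qed.
End borel.

(** * Lebesgue measure on R^n and Tonelli's theorem *)
Section lebn_theory.
Context {R : realType}.

Lemma rcons_rV_lift {n} (p : 'rV[R]_n * R) i :
  rcons_rV p ord0 (lift ord_max i) = p.1 ord0 i.
Proof. by rewrite mxE liftK. Qed.

Lemma rcons_rV_max {n} (p : 'rV[R]_n * R) : rcons_rV p ord0 ord_max = p.2.
Proof. by rewrite mxE unlift_none. Qed.

Let cube n k : set 'rV[R]_n := [set x | forall i, `|x ord0 i| < k%:R].

Let measurable_cube n k : measurable (cube n k).
Proof.
rewrite (_ : cube n k =
    \bigcap_i [set x : 'rV[R]_n | x ord0 i \in `]- k%:R, k%:R[]).
  rewrite -[X in measurable X]setCK setC_bigcap; apply: measurableC.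
  apply: countable_bigcupT_measurable; first exact: countableP.
  move=> i; apply: measurableC; rewrite -[X in measurable X]setTI.
  exact: (measurable_coord i measurableT (measurable_itv `]_, _[)).
by apply/seteqP; split=> x xk i //=; have := xk i;
  rewrite /= in_itv/= ltr_norml => ->.
Qed.

Let rcons_rV_cube n k :
  rcons_rV @^-1` cube n.+1 k = cube n k `*` [set` `]- k%:R, k%:R[].
Proof.
apply/seteqP; split=> [[x s] xsk|[x s] [/= xk sk] i].
  split=> [i|] /=; first by have := xsk (lift ord_max i); rewrite rcons_rV_lift.
  by have := xsk ord_max; rewrite rcons_rV_max in_itv/= ltr_norml.
rewrite mxE; case: unliftP => [j _|_] /=; first exact: xk.
by rewrite ltr_norml; move: sk; rewrite in_itv.
Qed.

Let lebn_cube n k : (lebn n (cube n k) < +oo)%E.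
Proof.
elim: n => [|n IHn]; first by rewrite /= diracE ltry.
rewrite /= /lebn_succ /pushforward rcons_rV_cube product_measure1E//.
- rewrite lte_mul_pinfty//; first by rewrite ge0_fin_numE.
  by rewrite /= lebesgue_measure_itv; case: ifPn; rewrite -?EFinB ltry.
- exact: measurable_cube.
Qed.

Lemma sigma_finite_lebn n : sigma_finite setT (@lebn R n).
Proof.
exists (cube n); last first.
  by move=> k; split; [exact: measurable_cube|exact: lebn_cube].
apply/esym/seteqP; split => // x _.
exists (Num.bound (\sum_i `|x ord0 i|)) => // i /=.
have S0 : 0 <= \sum_i `|x ord0 i| by exact: sumr_ge0.
by apply: le_lt_trans (archi_boundP S0); rewrite (bigD1 i)//= lerDl sumr_ge0.
Qed.

(** A transparent copy of lebn n, to which the sigma-finiteness required by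
    Tonelli's theorem can be attached: lebn n is the value of a recursive function
    that returns a bare measure. *)
Definition lebn_fun n : set 'rV[R]_n -> \bar R := lebn n.

HB.instance Definition _ n := Measure.on (lebn_fun n).

HB.instance Definition _ n :=
  Measure_isSigmaFinite.Build _ _ _ (lebn_fun n) (sigma_finite_lebn n).

Definition slebn n : {sigma_finite_measure set 'rV[R]_n -> \bar R} := lebn_fun n.

Lemma tonelli_lebn_xt n (f : 'rV[R]_n * R -> \bar R) :
  measurable_fun setT f -> (forall z, 0 <= f z)%E ->
  (\int[lebn_xt n]_z f z = \int[lebesgue_measure]_t \int[lebn n]_x f (x, t))%E.
Proof.
by move=> mf f0; exact: (@fubini_tonelli2 _ _ _ _ _ (slebn n) lebesgue_measure).
Qed.

Lemma tonelli_lebn_succ n (f : 'rV[R]_n.+1 -> \bar R) :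
  measurable_fun setT f -> (forall z, 0 <= f z)%E ->
  (\int[lebn n.+1]_x f x =
   \int[lebn n]_x' \int[lebesgue_measure]_s f (rcons_rV (x', s)))%E.
Proof.
move=> mf f0.
transitivity (\int[pushforward (lebn n \x lebesgue_measure)%E rcons_rV]_y f y)%E.
  by [].
rewrite ge0_integral_pushforward//; [|exact: measurable_rcons_rV].
rewrite preimage_setT.
apply: (@fubini_tonelli1 _ _ _ _ _ (slebn n) lebesgue_measure) => //.
- by apply: measurableT_comp => //; exact: measurable_rcons_rV.
- by move=> z; exact: f0.
Qed.

(** By Tonelli's theorem for the indicator function of a null set N, the slices of
    N have zero measure for almost every t. *)
Lemma ae_slice {n} {P : 'rV[R]_n * R -> Prop} : {ae lebn_xt n, forall z, P z} ->
  {ae lebesgue_measure, forall t, {ae lebn n, forall x, P (x, t)}}.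
Proof.
move=> [N [mN N0 PN]].
have mNs := measurable_fun_ysection (slebn n) mN.
have /(ae_eq_integral_abs _ measurableT mNs) :
    (\int[lebesgue_measure]_t `|(slebn n \o ysection N) t| = 0)%E.
  under eq_integral do rewrite gee0_abs//.
  rewrite -N0; apply/esym.
  apply: (@product_measure_unique _ _ _ _ _ (slebn n) lebesgue_measure
    (slebn n \x^ lebesgue_measure)%E) => // A B mA mB.
  exact: (product_measure2E (slebn n) lebesgue_measure mA mB).
apply: filterS => t /(_ I) /= Nt0.
exists (ysection N t); split => //; first exact: measurable_ysection.
by move=> x /= Pxt; rewrite /ysection/= inE; exact: PN.
Qed.

End lebn_theory.

Section tonelli_sets.
Context {R : realType}.

(** Tonelli's theorem on a cylinder. The measurability of the inner integral in t is
    part of the conclusion because the inner integrals are compared again in t;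
    likewise for x' in tonelli_rcons. *)
Lemma tonelli_slice {n} {Om : set 'rV[R]_n} {I : set R} {f : 'rV[R]_n * R -> \bar R} :
  measurable Om -> measurable I -> measurable_fun (Om `*` I) f ->
  (forall z, (Om `*` I) z -> 0 <= f z)%E ->
  measurable_fun I (fun t => \int[lebn n]_(x in Om) f (x, t))%E /\
  (\int[lebn_xt n]_(z in Om `*` I) f z =
   \int[lebesgue_measure]_(t in I) \int[lebn n]_(x in Om) f (x, t))%E.
Proof.
move=> mOm mI mf f0; set Q := Om `*` I.
have mQ : measurable Q by exact: measurableX.
have mfQ : measurable_fun setT (f \_ Q) by exact: (iffLR (measurable_restrictT f mQ) mf).
have fQ0 z : (0 <= (f \_ Q) z)%E.
  by rewrite /patch; case: ifPn => // /set_mem /f0.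
have inE t : (\int[lebn n]_x (f \_ Q) (x, t))%E =
    ((fun t => \int[lebn n]_(x in Om) f (x, t))%E \_ I) t.
  rewrite [RHS]/patch; case: ifPn => It.
    rewrite [RHS]integral_mkcond; apply: eq_integral => x _.
    by rewrite /patch in_setX It andbT.
  by rewrite integral0_eq// => x _; rewrite /patch in_setX (negbTE It) andbF.
split.
  apply: (iffRL (measurable_restrictT _ mI)).
  rewrite (_ : _ \_ _ = fun t => \int[lebn n]_x (f \_ Q) (x, t))%E; last first.
    by apply/funext => t; rewrite inE.
  exact: (@measurable_fun_fubini_tonelli_G _ _ _ _ _ (slebn n) (f \_ Q)).
rewrite integral_mkcond tonelli_lebn_xt// [RHS]integral_mkcond.
exact: eq_integral.
Qed.

Lemma tonelli_rcons {n} {Om : set 'rV[R]_n.+1} {f : 'rV[R]_n.+1 -> \bar R} :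
  measurable Om -> measurable_fun Om f -> (forall x, Om x -> 0 <= f x)%E ->
  let fiber x' := [set s | Om (rcons_rV (x', s))] in
  measurable_fun setT
    (fun x' => \int[lebesgue_measure]_(s in fiber x') f (rcons_rV (x', s)))%E /\
  (\int[lebn n.+1]_(x in Om) f x =
   \int[lebn n]_x'
     \int[lebesgue_measure]_(s in fiber x') f (rcons_rV (x', s)))%E.
Proof.
move=> mOm mf f0 fiber.
have mfQ : measurable_fun setT (f \_ Om).
  exact: (iffLR (measurable_restrictT f mOm) mf).
have fQ0 z : (0 <= (f \_ Om) z)%E.
  by rewrite /patch; case: ifPn => // /set_mem /f0.
have inE x' : (\int[lebesgue_measure]_s (f \_ Om) (rcons_rV (x', s)))%E =
    (\int[lebesgue_measure]_(s in fiber x') f (rcons_rV (x', s)))%E.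
  by rewrite [RHS]integral_mkcond.
split.
  rewrite (_ : (fun _ => _) = fun x' =>
     \int[lebesgue_measure]_s (f \_ Om \o rcons_rV) (x', s))%E; last first.
    by apply/funext => x'; rewrite -inE.
  apply: (@measurable_fun_fubini_tonelli_F _ _ _ _ _ lebesgue_measure) => //.
    by apply: measurableT_comp => //; exact: measurable_rcons_rV.
  by move=> z; exact: fQ0.
rewrite integral_mkcond tonelli_lebn_succ//.
by apply: eq_integral => x' _; rewrite inE.
Qed.

End tonelli_sets.

(** * The half-ball and its fibers *)
Section halfball.
Context {R : realType}.

Lemma dotv_rcons n (x' : 'rV[R]_n) s :
  dotv (rcons_rV (x', s)) (rcons_rV (x', s)) = dotv x' x' + s ^+ 2.
Proof.
rewrite /dotv big_ord_recr/= rcons_rV_max -expr2; congr (_ + _).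
apply: eq_bigr => i _.
have -> : widen_ord (leqnSn n) i = lift ord_max i.
  by apply: val_inj; rewrite /= /bump leqNgt ltn_ord.
by rewrite rcons_rV_lift.
Qed.

Lemma dotv_ge0 {n} (x : 'rV[R]_n) : 0 <= dotv x x.
Proof. by apply: sumr_ge0 => i _; rewrite -expr2 sqr_ge0. Qed.

Lemma sqr_coord_le_dotv {n} (x : 'rV[R]_n) i : x ord0 i ^+ 2 <= dotv x x.
Proof.
rewrite /dotv (bigD1 i)//= -expr2 lerDl.
by apply: sumr_ge0 => j _; rewrite -expr2 sqr_ge0.
Qed.

Lemma eball0P {n} {x : 'rV[R]_n} {r} : 0 < r -> eball 0 r x <-> dotv x x < r ^+ 2.
Proof.
move=> r0; rewrite /eball/= subr0 /enorm.
rewrite -(ltr_pXn2r (ltn0Sn 1)) ?nnegrE ?sqrtr_ge0 1?ltW//.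
by rewrite sqr_sqrtr ?dotv_ge0.
Qed.

Lemma halfball_rcons {n} {x' : 'rV[R]_n} {s r} : 0 < r ->
  halfball r (rcons_rV (x', s)) <-> 0 < s /\ dotv x' x' + s ^+ 2 < r ^+ 2.
Proof.
move=> r0; rewrite /halfball/= rcons_rV_max; split => [[/(eball0P r0)]|[s0 h]].
  by rewrite dotv_rcons.
by split => //; apply/(eball0P r0); rewrite dotv_rcons.
Qed.

Lemma flatP {n} {x' : 'rV[R]_n} {r} : 0 < r -> flat r x' <-> dotv x' x' < r ^+ 2.
Proof.
move=> r0; rewrite /flat/=; split => [/(eball0P r0)|h].
  by rewrite dotv_rcons expr0n/= addr0.
by apply/(eball0P r0); rewrite dotv_rcons expr0n/= addr0.
Qed.

Lemma measurable_dotv n : measurable_fun setT (fun x : 'rV[R]_n => dotv x x).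
Proof.
apply: measurable_sum => i.
by apply: measurable_funM; exact: measurable_coord.
Qed.

Lemma measurable_flat {n r} : 0 < r -> measurable (flat r : set 'rV[R]_n).
Proof.
move=> r0; rewrite (_ : flat r = (fun x => dotv x x) @^-1` `]-oo, (r ^+ 2)[).
  by rewrite -[X in measurable X]setTI; exact: measurable_dotv.
by apply/seteqP; split => x /= => [/(flatP r0)|?]; rewrite ?in_itv//; exact/(flatP r0).
Qed.

Lemma measurable_halfball {n r} : 0 < r -> measurable (halfball r : set 'rV[R]_n.+1).
Proof.
move=> r0; rewrite (_ : halfball r = ((fun x => dotv x x) @^-1` `]-oo, (r ^+ 2)[)
    `&` ((fun x => x ord0 ord_max) @^-1` `]0, +oo[)).
  apply: measurableI; rewrite -[X in measurable X]setTI.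
    exact: measurable_dotv.
  exact: measurable_coord.
apply/seteqP; split => x /=; rewrite !in_itv/= ?andbT.
  by move=> [/(eball0P r0)].
by move=> [xr xn]; split => //=; exact/(eball0P r0).
Qed.

End halfball.

(** * Increments of a function of one variable *)
Section one_dim.
Context {R : realType}.
Local Notation mu := (@lebesgue_measure R).

(** The Cauchy-Schwarz inequality for the increment of g, obtained by integrating
    2 c g' - c^2 <= g'^2 for the constant c that is optimal, the mean slope. *)
Lemma sqr_le_integral {g g' : R -> R} {s : R} : 0 < s ->
  (forall x : R, is_derive x (1 : R) g (g' x)) -> continuous g' ->
  (((g s - g 0) ^+ 2)%:E <=
   s%:E * \int[mu]_(x in `[0%R, s]) (g' x ^+ 2)%:E)%E.
Proof.
move=> s0 dg cg'.
pose c := (g s - g 0) / s.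
pose G x := 2 * c * g x - c ^+ 2 * x.
pose G' x := 2 * c * g' x - c ^+ 2.
have dG (x : R) : is_derive x (1 : R) G (G' x).
  have := dg x; rewrite /G /G' => dgx.
  pose G1 : R -> R^o := (2 * c) *: (g : R -> R^o) - (c ^+ 2) *: (id : R -> R^o).
  change (is_derive (x : R) (1 : R) G1 (2 * c * g' x - c ^+ 2)).
  apply: is_derive_eq.
  by rewrite /= /GRing.scale/= mulr1.
have cG' : continuous G'.
  move=> x; apply: cvgB; last exact: cvg_cst.
  by apply: cvgM; [exact: cvg_cst|exact: cg'].
have cG : continuous G.
  by move=> x; apply/differentiable_continuous/derivable1_diffP; have [] := dG x.
have G'E : (\int[mu]_(x in `[0%R, s]) (G' x)%:E = ((g s - g 0) ^+ 2 / s)%:E)%E.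
  rewrite (@continuous_FTC2 _ _ G)//.
  - rewrite -EFinB /G mulr0 subr0; congr EFin.
    rewrite (_ : _ - _ = 2 * c * (g s - g 0) - c ^+ 2 * s); last by lra.
    by rewrite /c; field; rewrite gt_eqF.
  - exact: continuous_subspaceT.
  - split; first by move=> x _; have [] := dG x.
    + exact/cvg_at_right_filter/cG.
    + exact/cvg_at_left_filter/cG.
  - by move=> x _; rewrite derive1E; have [] := dG x.
rewrite -lee_pdivrMl// -EFinM mulrC -G'E.
have cg2 : continuous (fun x => g' x ^+ 2).
  by move=> x; apply: cvgM; exact: cg'.
apply: le_integral => //.
- apply: continuous_compact_integrable; first exact: segment_compact.
  exact: continuous_subspaceT.
- apply: continuous_compact_integrable; first exact: segment_compact.
  exact: continuous_subspaceT.
- move=> x _; rewrite lee_fin /G' -subr_ge0.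
  rewrite (_ : _ - _ = (g' x - c) ^+ 2); first exact: sqr_ge0.
  by ring.
Qed.

End one_dim.

(** * Poincare inequality on the half-ball *)
Section poincare_smooth.
Context {R : realType}.
Local Notation mu := (@lebesgue_measure R).

(** S stands for the fiber of the half-ball over a point x' of the flat part; the
    first condition on it bounds its length, the second says that it is reached
    from the flat part without leaving the half-ball. Every value of g on S is then
    controlled by g 0 and by the integral of g'^2 over the whole of S. *)
Lemma poincare_fiber {S : set R} {r : R} {g g' : R -> R} : 0 < r ->
  measurable S -> S `<=` `]0, r[ -> (forall s, S s -> `]0, s] `<=` S) ->
  (forall x : R, is_derive x (1 : R) g (g' x)) -> continuous g' ->
  (\int[mu]_(s in S) (g s ^+ 2)%:E <=
   (2 * r * g 0 ^+ 2)%:E +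
   (2 * r ^+ 2)%:E * \int[mu]_(s in S) (g' s ^+ 2)%:E)%E.
Proof.
move=> r0 mS Sr S0 dg cg'.
have mg2 (D : set R) : measurable D ->
    measurable_fun D (fun s => (g' s ^+ 2)%:E : \bar R).
  move=> mD; apply: measurable_funTS; apply/measurable_EFinP.
  by apply: measurable_funX; exact: continuous_measurable_fun.
set J := (\int[mu]_(s in S) (g' s ^+ 2)%:E)%E.
have J0 : (0 <= J)%E by apply: integral_ge0 => s _; rewrite lee_fin sqr_ge0.
pose c : \bar R := ((2 * g 0 ^+ 2)%:E + (2 * r)%:E * J)%E.
have c0 : (0 <= c)%E.
  apply: adde_ge0; first by rewrite lee_fin mulr_ge0// sqr_ge0.
  by apply: mule_ge0 => //; rewrite lee_fin mulr_ge0// ltW.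
have gc s : S s -> ((g s ^+ 2)%:E <= c)%E.
  move=> Ss; have /= := Sr _ Ss; rewrite in_itv/= => /andP[s0 sr].
  have sJ : (((g s - g 0) ^+ 2)%:E <= r%:E * J)%E.
    apply: le_trans (sqr_le_integral s0 dg cg') _.
    apply: lee_pmul; [by rewrite lee_fin ltW| |by rewrite lee_fin ltW|].
      by apply: integral_ge0 => x _; rewrite lee_fin sqr_ge0.
    rewrite -integral_itv_obnd_cbnd; last exact: mg2.
    apply: ge0_subset_integral => //; first exact: mg2.
      by move=> x _; rewrite lee_fin sqr_ge0.
    exact: S0.
  apply: (@le_trans _ _ (2 * g 0 ^+ 2 + 2 * (g s - g 0) ^+ 2)%:E).
    rewrite lee_fin -subr_ge0.
    rewrite (_ : _ - _ = (g s - 2 * g 0) ^+ 2); first exact: sqr_ge0.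
    by ring.
  by rewrite EFinD /c leeD2l// !EFinM -muleA lee_pmul2l.
(* c bounds g^2 on S, and the length of S is at most r *)
apply: (@le_trans _ _ (\int[mu]_(s in S) cst c s)%E).
  by apply: le_integral_ge0 => // s _; rewrite lee_fin sqr_ge0.
rewrite integral_cst//.
apply: (@le_trans _ _ (c * r%:E)%E).
  apply: lee_pmul => //.
  apply: (@le_trans _ _ (mu `]0, r[)); first by apply: le_measure; rewrite ?inE.
  by rewrite lebesgue_measure_itv/= lte_fin r0 -EFinB subr0.
rewrite /c ge0_muleDl ?mule_ge0//; last 2 first.
  by rewrite lee_fin mulr_ge0 ?sqr_ge0.
  by rewrite lee_fin mulr_ge0// ltW.
rewrite -EFinM muleAC -EFinM leeD//; first by rewrite lee_fin mulrAC.
by rewrite -mulrA -expr2.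
Qed.

Section half_ball.
Context {n : nat}.
Local Notation V := 'rV[R]_n.+1.
Local Notation en := (delta_mx ord0 ord_max : V).

Lemma rcons_rVD (x' : 'rV[R]_n) (h s : R) :
  rcons_rV (x', h + s) = h *: en + rcons_rV (x', s).
Proof.
apply/rowP => i; rewrite !mxE eqxx/=.
case: unliftP => [j ->|->] /=; last by rewrite eqxx mulr1.
by rewrite eq_sym (negbTE (neq_lift _ _)) mulr0 add0r.
Qed.

Lemma continuous_rcons_rV (x' : 'rV[R]_n) :
  continuous (fun s => rcons_rV (x', s) : V).
Proof.
rewrite (_ : (fun _ => _) = fun s => s *: en + rcons_rV (x', 0)); last first.
  by apply/funext => s; rewrite -[in LHS](addr0 s) rcons_rVD.
by move=> s; apply: cvgD; [apply: cvgZl; exact: cvg_id|exact: cvg_cst].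
Qed.

Lemma is_derive_rcons_rV (phi : V -> R) (x' : 'rV[R]_n) (s : R) :
  derivable phi (rcons_rV (x', s)) en ->
  is_derive s (1 : R) (fun s => phi (rcons_rV (x', s)))
    ('D_en phi (rcons_rV (x', s))).
Proof.
move=> dphi.
have E : (fun h : R => h^-1 *: (((fun s => phi (rcons_rV (x', s))) \o shift s)
      (h *: (1 : R)) - phi (rcons_rV (x', s)))) =
    (fun h : R => h^-1 *: ((phi \o shift (rcons_rV (x', s))) (h *: en) -
      phi (rcons_rV (x', s)))).
  by apply/funext => h /=; rewrite -rcons_rVD /GRing.scale/= mulr1.
apply: DeriveDef; first by rewrite /derivable E.
by rewrite /derive E.
Qed.

(** The one-dimensional inequality on every vertical fiber, integrated over x';
    fibers over points outside the flat part are empty. *)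
Lemma poincare_smooth {r : R} {phi : V -> R} : 0 < r ->
  continuous phi -> (forall x, derivable phi x en) -> continuous ('D_en phi) ->
  (\int[lebn n.+1]_(x in halfball r) (phi x ^+ 2)%:E <=
   (2 * r)%:E * \int[lebn n]_(x' in flat r) (phi (rcons_rV (x', 0)) ^+ 2)%:E +
   (2 * r ^+ 2)%:E *
     \int[lebn n.+1]_(x in halfball r) (('D_en phi x) ^+ 2)%:E)%E.
Proof.
move=> r0 cphi dphi cdphi.
have mOm := @measurable_halfball R n _ r0.
have msq (f : V -> R) : continuous f ->
    measurable_fun (halfball r) (fun x => (f x ^+ 2)%:E : \bar R).
  move=> cf; apply: measurable_funTS; apply/measurable_EFinP.
  by apply: measurable_funX; exact: continuous_measurable_rV.
have sq0 (f : V -> R) x : halfball r x -> (0 <= (f x ^+ 2)%:E)%E.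
  by rewrite lee_fin sqr_ge0.
have [_ ->] := tonelli_rcons mOm (msq _ cphi) (sq0 phi).
have [mJ ->] := tonelli_rcons mOm (msq _ cdphi) (sq0 ('D_en phi)).
set J := fun x' => (\int[mu]_(s in _) _)%E in mJ *.
have J0 x' : (0 <= J x')%E.
  by apply: integral_ge0 => s _; rewrite lee_fin sqr_ge0.
pose tr x' : \bar R := (phi (rcons_rV (x', 0)) ^+ 2)%:E.
have tr0 x' : (0 <= (tr \_ (flat r)) x')%E.
  by rewrite /patch; case: ifP => //; rewrite /tr lee_fin sqr_ge0.
have mtr : measurable_fun setT (tr \_ (flat r)).
  apply: (iffLR (measurable_restrictT _ (measurable_flat r0))).
  apply: measurable_funTS; apply/measurable_EFinP; apply: measurable_funX.
  apply: measurableT_comp; first exact: continuous_measurable_rV.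
  apply: measurable_fun_rV => i; rewrite /rcons_rV.
  under eq_fun do rewrite mxE.
  case: (unlift ord_max i) => [j|]; last exact: measurable_cst.
  exact: (measurable_coord j).
have r2 : (0 <= (2 * r)%:E)%E by rewrite lee_fin mulr_ge0// ltW.
have r22 : (0 <= (2 * r ^+ 2)%:E)%E by rewrite lee_fin mulr_ge0// sqr_ge0.
rewrite (integral_mkcond (flat r)) -/tr -[X in (_ <= _ + _ * X)%E]/(\int[_]_x' J x')%E.
rewrite -!ge0_integralZl//.
rewrite -ge0_integralD//; last 4 first.
- by move=> x' _; apply: mule_ge0.
- exact: measurable_funeM.
- by move=> x' _; apply: mule_ge0 => //; exact: J0.
- exact: measurable_funeM.
apply: le_integral_ge0 => x' _.
  by apply: integral_ge0 => s _; rewrite lee_fin sqr_ge0.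
have [fx'|fx'] := pselect (flat r x'); last first.
  rewrite (_ : [set s | _] = set0).
    by rewrite integral_set0; apply: adde_ge0; exact: mule_ge0.
  rewrite -subset0 => s /= /(halfball_rcons r0)[s0 xs]; apply/fx'/(flatP r0).
  by apply: le_lt_trans xs; rewrite lerDl sqr_ge0.
rewrite [(tr \_ _) x']/patch mem_set// /tr -EFinM.
apply: (poincare_fiber (g := fun s => phi (rcons_rV (x', s)))
  (g' := fun s => 'D_en phi (rcons_rV (x', s)))) => //.
- rewrite -[X in measurable X]setTI.
  have mrc : measurable_fun setT (fun s : R => rcons_rV (x', s) : V).
    apply: measurable_fun_rV => i; rewrite /rcons_rV.
    under eq_fun do rewrite mxE.
    by case: (unlift ord_max i) => [j|]; [exact: measurable_cst|exact: measurable_id].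
  exact: mrc.
- move=> s /(halfball_rcons r0)[s0 xs]; rewrite /= in_itv/= s0/=.
  rewrite -(ltr_pXn2r (ltn0Sn 1)) ?nnegrE ?(ltW s0) ?(ltW r0)//.
  by apply: le_lt_trans xs; rewrite lerDr dotv_ge0.
- move=> s /(halfball_rcons r0)[s0 xs] t /=; rewrite in_itv/= => /andP[t0 ts].
  apply/(halfball_rcons r0); split => //; apply: le_lt_trans xs.
  by rewrite lerD2l ler_pXn2r// nnegrE ltW.
- by move=> s; apply: is_derive_rcons_rV; exact: dphi.
- move=> s; apply: (continuous_comp (f := fun s => rcons_rV (x', s))
    (g := 'D_en phi)); first exact: continuous_rcons_rV.
  exact: cdphi.
Qed.

End half_ball.
End poincare_smooth.

Section poincare_trace.
Context {R : realType}.

Lemma sqrrD_le2 (a b : R) : (a + b) ^+ 2 <= 2 * a ^+ 2 + 2 * b ^+ 2.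
Proof.
rewrite -subr_ge0 (_ : _ - _ = (a - b) ^+ 2); first exact: sqr_ge0.
by ring.
Qed.

Lemma ae_eq_integral_sqr {d} {T : measurableType d}
    {m : {measure set T -> \bar R}} {D : set T} (f g : T -> R) :
  {ae m, forall x, D x -> f x = g x} ->
  (\int[m]_(x in D) (f x ^+ 2)%:E = \int[m]_(x in D) (g x ^+ 2)%:E)%E.
Proof.
move=> fg; apply: ae_eq_integral_ge0.
- by move=> x _; rewrite lee_fin sqr_ge0.
- by move=> x _; rewrite lee_fin sqr_ge0.
- by apply: filterS fg => x fgx /fgx ->.
Qed.

(** The form of the inequality f^2 <= 2 (g - f)^2 + 2 g^2 used to replace a Sobolev
    function by a smooth approximation. Additivity of the integral needs
    measurability, hence the passage to Borel representatives. *)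
Lemma integral_sqr_le2 {d} {T : measurableType d}
    {m : {measure set T -> \bar R}} {D : set T} {f g : T -> R} : measurable D ->
  aemeasurable m D f -> aemeasurable m D g ->
  (\int[m]_(x in D) (f x ^+ 2)%:E <=
   2%:E * \int[m]_(x in D) ((g x - f x) ^+ 2)%:E +
   2%:E * \int[m]_(x in D) (g x ^+ 2)%:E)%E.
Proof.
move=> mD [f1 mf1 ff1] [g1 mg1 gg1].
rewrite (ae_eq_integral_sqr _ _ ff1) (ae_eq_integral_sqr _ _ gg1).
rewrite (ae_eq_integral_sqr (fun x => g x - f x)
  (fun x => g1 x - f1 x)); last first.
  by apply: filterS2 ff1 gg1 => x h1 h2 Dx; rewrite h1// h2.
have sq0 (h : T -> R) x : D x -> (0 <= (h x ^+ 2)%:E)%E.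
  by rewrite lee_fin sqr_ge0.
have mgf : measurable_fun D (fun x => ((g1 x - f1 x) ^+ 2)%:E : \bar R).
  by apply/measurable_EFinP; apply: measurable_funX; exact: measurable_funB.
have mg : measurable_fun D (fun x => (g1 x ^+ 2)%:E : \bar R).
  by apply/measurable_EFinP; exact: measurable_funX.
rewrite -!ge0_integralZl//; try exact: (sq0 (fun x => g1 x - f1 x)).
- rewrite -ge0_integralD//; last 4 first.
  + by move=> x _; rewrite -EFinM lee_fin mulr_ge0// sqr_ge0.
  + exact: measurable_funeM.
  + by move=> x _; rewrite -EFinM lee_fin mulr_ge0// sqr_ge0.
  + exact: measurable_funeM.
  apply: le_integral_ge0 => x _; first by rewrite lee_fin sqr_ge0.
  rewrite -!EFinM -EFinD lee_fin.
  have -> : f1 x ^+ 2 = ((f1 x - g1 x) + g1 x) ^+ 2 by rewrite subrK.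
  by rewrite -[in leRHS]opprB sqrrN; exact: sqrrD_le2.
- exact: (sq0 g1).
Qed.

(** Limit of poincare_smooth along the smooth functions that define the trace: the
    boundary term and both approximation errors tend to 0. The constant 8 is 2,
    from the passage from v to phi k, times 2, from poincare_smooth, times 2, from
    the passage from the derivative of phi k to g. *)
Lemma poincare_zero_trace {n} {r : R} {v : 'rV[R]_n.+1 -> R}
    {g : 'rV[R]_n.+1 -> 'rV[R]_n.+1} : 0 < r ->
  W12 (halfball r) v g -> zero_trace r v g ->
  (\int[lebn n.+1]_(x in halfball r) (v x ^+ 2)%:E <=
   (8 * r ^+ 2)%:E *
     \int[lebn n.+1]_(x in halfball r) ((g x ord0 ord_max) ^+ 2)%:E)%E.
Proof.
move=> r0 [[mv _] L2g _] [phi [sphi cphi] tphi].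
have [mg _] := L2g ord_max.
set C := (\int[_]_(x in _) ((g x ord0 ord_max) ^+ 2)%:E)%E.
set L := (\int[_]_(x in _) _)%E.
have mOm := @measurable_halfball R n _ r0.
pose eps k := W12_sqnorm (halfball r) (phi k \- v) (fun x => grad (phi k) x - g x).
pose del k : \bar R :=
  (\int[lebn n]_(x' in flat r) (phi k (rcons_rV (x', 0)) ^+ 2)%:E)%E.
have aeW12 (f : 'rV[R]_n.+1 -> R) : continuous f ->
    aemeasurable (lebn n.+1) (halfball r) f.
  move=> cf; exists f; last exact: aeW.
  by apply: measurable_funTS; exact: continuous_measurable_rV.
pose B k : \bar R := (2%:E * eps k + 2%:E * ((2 * r)%:E * del k +
     (2 * r ^+ 2)%:E * (2%:E * eps k + 2%:E * C)))%E.
have key k : (L <= B k)%E.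
  have [cp dp] := sphi k 1%N.
  have {}dp := dp (delta_mx ord0 ord_max).
  case: dp => dp cdp.
  set dphi := 'D_(delta_mx ord0 ord_max) (phi k) in cdp.
  have e1 : (\int[lebn n.+1]_(x in halfball r) ((phi k x - v x) ^+ 2)%:E
             <= eps k)%E.
    rewrite leeDl// integral_ge0// => x _; rewrite lee_fin dotv_ge0//.
  have e2 : (\int[lebn n.+1]_(x in halfball r)
               ((dphi x - g x ord0 ord_max) ^+ 2)%:E <= eps k)%E.
    apply: (@le_trans _ _ (\int[lebn n.+1]_(x in halfball r)
      (dotv (grad (phi k) x - g x) (grad (phi k) x - g x))%:E)%E).
      apply: le_integral_ge0 => x _; first by rewrite lee_fin sqr_ge0.
      rewrite lee_fin; apply: le_trans (sqr_coord_le_dotv _ ord_max).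
      by rewrite !mxE.
    by rewrite leeDr// integral_ge0// => x _; rewrite lee_fin sqr_ge0.
  have e3 : (\int[lebn n.+1]_(x in halfball r) (dphi x ^+ 2)%:E <=
      2%:E * eps k + 2%:E * C)%E.
    apply: le_trans (integral_sqr_le2 mOm (aeW12 _ cdp) mg) _.
    rewrite leeD2r// lee_pmul2l//.
    rewrite (_ : (\int[_]_(x in _) _)%E = (\int[lebn n.+1]_(x in halfball r)
               ((dphi x - g x ord0 ord_max) ^+ 2)%:E)%E)//.
    by apply: eq_integral => x _; rewrite -sqrrN opprB.
  apply: le_trans (integral_sqr_le2 mOm mv (aeW12 _ cp)) _.
  apply: leeD; first by rewrite lee_pmul2l.
  rewrite lee_pmul2l//.
  apply: le_trans (poincare_smooth r0 cp dp cdp) _.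
  apply: leeD2l; apply: lee_wpmul2l => //.
  by rewrite lee_fin mulr_ge0// sqr_ge0.
have C0 : (0 <= C)%E.
  by apply: integral_ge0 => x _; rewrite lee_fin sqr_ge0.
have -> : ((8 * r ^+ 2)%:E * C = 2%:E * 0 + 2%:E * ((2 * r)%:E * 0 +
     (2 * r ^+ 2)%:E * (2%:E * 0 + 2%:E * C)))%E.
  rewrite !mule0 !add0e !muleA -!EFinM; congr (_%:E * _)%E.
  by ring.
suff cB : B @ \oo --> (2%:E * 0 + 2%:E * ((2 * r)%:E * 0 +
     (2 * r ^+ 2)%:E * (2%:E * 0 + 2%:E * C)))%E.
  by apply: cvge_ge cB; exact: nearW key.
have r20 : (0 <= (2 * r ^+ 2)%:E)%E by rewrite lee_fin mulr_ge0// sqr_ge0.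
do 2! (apply: cvgeD; [|exact: cvgeZl|apply: cvgeZl => //];
  first by apply: ge0_adde_def; rewrite !inE ?mule0// ?add0e !mule_ge0).
apply: cvgeD; [|exact: cvgeZl|exact: cvg_cst].
by apply: ge0_adde_def; rewrite !inE ?mule0// mule_ge0.
Qed.
End poincare_trace.

(** * Integration in time *)

(** Integration of poincare_zero_trace over t. The slices of u and Du are only known
    through Borel functions U and G equal to them almost everywhere in (x, t); for
    almost every t the slices agree almost everywhere in x. *)
Lemma poincare_slices {R : realType} {n : nat} {r : R} {I : set R}
    {u : 'rV[R]_n.+1 * R -> R} {Du : 'rV[R]_n.+1 * R -> 'rV[R]_n.+1} :
  0 < r -> measurable I -> L2W12 (halfball r) I u Du ->
  {ae lebesgue_measure, forall t, I t -> zero_trace r (slice u t) (slice Du t)} ->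
  (\int[lebn_xt n.+1]_(z in halfball r `*` I) (u z ^+ 2)%:E <=
   (8 * r ^+ 2)%:E *
     \int[lebn_xt n.+1]_(z in halfball r `*` I) (Du z ord0 ord_max ^+ 2)%:E)%E.
Proof.
move=> r0 mI [[[U mU uU] _] L2Du Wu] tru.
have [[G mG DuG] _] := L2Du ord_max.
have mOm := @measurable_halfball R n _ r0.
rewrite (ae_eq_integral_sqr _ _ uU) (ae_eq_integral_sqr _ _ DuG).
have msq (f : 'rV[R]_n.+1 * R -> R) : measurable_fun (halfball r `*` I) f ->
    measurable_fun (halfball r `*` I) (fun z => (f z ^+ 2)%:E : \bar R).
  by move=> mf; apply/measurable_EFinP; exact: measurable_funX.
have sq0 (f : 'rV[R]_n.+1 * R -> R) z : (halfball r `*` I) z ->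
    (0 <= (f z ^+ 2)%:E)%E by rewrite lee_fin sqr_ge0.
have [mIU ->] := tonelli_slice mOm mI (msq _ mU) (sq0 U).
have [mIG ->] := tonelli_slice mOm mI (msq _ mG) (sq0 G).
have i0 (f : 'rV[R]_n.+1 * R -> R) t : I t ->
    (0 <= \int[lebn n.+1]_(x in halfball r) (f (x, t) ^+ 2)%:E)%E.
  by move=> _; apply: integral_ge0 => x _; rewrite lee_fin sqr_ge0.
have c0 : (0 <= (8 * r ^+ 2)%:E)%E by rewrite lee_fin mulr_ge0// sqr_ge0.
rewrite -ge0_integralZl//; last exact: (i0 G).
apply: ae_le_integral_ge0; first exact: (i0 U).
  by move=> t It; apply: mule_ge0 => //; exact: i0.
have Fae : Filter (almost_everywhere (@lebesgue_measure R)).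
  exact: (ae_filter_ringOfSetsType (@lebesgue_measure R)).
have tr : {ae lebesgue_measure, forall t, I t ->
    W12 (halfball r) (slice u t) (slice Du t) /\
    zero_trace r (slice u t) (slice Du t)}.
  by apply: (filterS2 Fae) Wu tru => t Wt trt It; split; [exact: Wt|exact: trt].
apply: (filterS3 Fae) tr (ae_slice uU) (ae_slice DuG) => t tr ut Gt It.
have [Wt trt] := tr It.
have -> : (\int[lebn n.+1]_(x in halfball r) (U (x, t) ^+ 2)%:E =
           \int[lebn n.+1]_(x in halfball r) (slice u t x ^+ 2)%:E)%E.
  apply: (ae_eq_integral_sqr (fun x => U (x, t))).
  by apply: filterS ut => x uUx Omx; rewrite -uUx.
have -> : (\int[lebn n.+1]_(x in halfball r) (G (x, t) ^+ 2)%:E =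
    \int[lebn n.+1]_(x in halfball r) (slice Du t x ord0 ord_max ^+ 2)%:E)%E.
  apply: (ae_eq_integral_sqr (fun x => G (x, t))
    (fun x => slice Du t x ord0 ord_max)).
  by apply: filterS Gt => x DuGx Omx; rewrite -DuGx.
exact: poincare_zero_trace Wt trt.
Qed.

Theorem lemma6p4 (R : realType) (n : nat) (nu M0 : R)
  (hnu : 0 < nu < 1) (hM0 : 1 <= M0) :
  exists N : R, 0 < N /\
  forall (beta : 'rV[R]_n.+1 -> R) (r : R)
    (A : 'rV[R]_n.+1 * R -> 'M[R]_n.+1) (F : 'rV[R]_n.+1 * R -> 'rV[R]_n.+1)
    (u : 'rV[R]_n.+1 * R -> R) (Du : 'rV[R]_n.+1 * R -> 'rV[R]_n.+1),
  weight beta ->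
  Aq (1 + 2 / (n0 n.+1)%:R) (fun x => (beta x)^-1) ->
  (Aq_char (1 + 2 / (n0 n.+1)%:R) (fun x => (beta x)^-1)%R <= M0%:E)%E ->
  0 < r ->
  (forall i j, aemeasurable (lebn_xt n.+1) (Qplus beta r)
    (fun z => A z i j)) ->
  elliptic nu (Qplus beta r) A ->
  What r (Gam beta r) beta u Du ->
  L2xt (Qplus beta r) F ->
  weak_solution (Qplus beta r) beta A F u Du ->
  (\int[lebn_xt n.+1]_(z in Qplus beta r) (u z ^+ 2)%:E <=
   N%:E * ((r ^+ 2)%:E *
             (\int[lebn_xt n.+1]_(z in Qplus beta r)
                (dotv (Du z) (Du z) + dotv (F z) (F z))%:E) +
           ((\int[lebn n.+1]_(x in eball 0 r) (beta x)%:E)^-1 *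
            \int[lebn n.+1]_(x in eball 0 r) (Theta beta r x ^+ 2)%:E) *
           (\int[lebn_xt n.+1]_(z in Qplus beta r) (u z ^+ 2)%:E)))%E.
Proof.
exists 8; split => // beta r A F u Du [_ beta0 _ _] _ _ r0 _ _ [Wu tru _] _ _.
(* the time interval of Qplus is measurable whatever the value of Psi beta r *)
apply: le_trans (poincare_slices r0 (measurable_itv _) Wu tru) _.
rewrite EFinM -muleA lee_pmul2l//.
apply: (@le_trans _ _ ((r ^+ 2)%:E * \int[lebn_xt n.+1]_(z in Qplus beta r)
    (dotv (Du z) (Du z) + dotv (F z) (F z))%:E)%E).
  apply: lee_wpmul2l; first by rewrite lee_fin sqr_ge0.
  apply: le_integral_ge0 => z _; rewrite lee_fin ?sqr_ge0//.
  by apply: le_trans (sqr_coord_le_dotv _ _) _; rewrite lerDl dotv_ge0.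
(* it remains to add the nonnegative term with Theta *)
rewrite leeDl// !mule_ge0//.
- by rewrite inve_ge0 integral_ge0// => x _; rewrite lee_fin.
- by apply: integral_ge0 => x _; rewrite lee_fin sqr_ge0.
- by apply: integral_ge0 => x _; rewrite lee_fin sqr_ge0.
Qed.
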